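(* For all integers $k\ge 3$, $$\sup_{(X,Y)\in\mathcal C_{\mathcal I}}\mathbb E|X-Y|^{k}=\sup_{n\in\mathbb Z_+}\ \sup_{G\in\mathcal B(n,n)}\ \frac1{n^{2+k}}\sum_{i,j=1}^{n}|\deg(x_i)-\deg(y_j)|^{k}.$$
   Context: A pair $(X,Y)$ of random variables on a common probability space $(\Omega,\mathcal F,\mathbb P)$ is called coherent if there exist an event $A\in\mathcal F$ and sub-$\sigma$-fields $\mathcal G,\mathcal H\subset\mathcal F$ such that $X=\mathbb P(A|\mathcal G)$ and $Y=\mathbb P(A|\mathcal H)$. $\mathcal C_{\mathcal I}$ denotes the family of all coherent pairs $(X,Y)$ (over all probability spaces, events and sub-$\sigma$-fields) with $X$ and $Y$ independent. $\mathbb Z_+$ is the set of positive integers. $\mathcal B(n,n)$ is the set of all bipartite simple graphs whose vertex set is the disjoint union of two $n$-element groups $\{x_1,\dots,x_n\}\cup\{y_1,\dots,y_n\}$, every edge joining some $x_i$ to some $y_j$; $\deg(v)$ is the degree of the vertex $v$ in the graph. *)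

(* Defs.v *)
From HB Require Import structures.
From mathcomp Require Import all_boot all_order all_algebra.
From mathcomp Require Import all_classical all_reals all_analysis.
Set Implicit Arguments.
Unset Strict Implicit.
Unset Printing Implicit Defensive.
Import Order.TTheory GRing.Theory Num.Theory.
Import numFieldNormedType.Exports.
Local Open Scope classical_set_scope.
Local Open Scope ring_scope.

Definition sub_sigma_field (d : measure_display) (T : measurableType d)
    (G : set (set T)) : Prop :=
  sigma_algebra setT G /\ G `<=` @measurable d T.

(* [is_cond_prob P A G X] says that X is a version of P(A | G).  Conditional
   probabilities being defined up to null sets, "X = P(A | G)" is read this
   way. *)
Definition is_cond_prob (d : measure_display) (T : measurableType d)
    (R : realType) (P : probability T R) (A : set T) (G : set (set T))
    (X : T -> R) : Prop :=
  [/\ forall B : set R, measurable B -> G (X @^-1` B),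
      P.-integrable setT (EFin \o X) &
      forall E : set T, G E -> (\int[P]_(w in E) (X w)%:E)%E = P (A `&` E)].

Definition coherent (d : measure_display) (T : measurableType d)
    (R : realType) (P : probability T R) (X Y : {RV P >-> R}) : Prop :=
  exists (A : set T) (G H : set (set T)),
    [/\ measurable A, sub_sigma_field G, sub_sigma_field H,
        is_cond_prob P A G X & is_cond_prob P A H Y].

Definition independent_RV (d : measure_display) (T : measurableType d)
    (R : realType) (P : probability T R) (X Y : {RV P >-> R}) : Prop :=
  forall B C : set R, measurable B -> measurable C ->
    P (X @^-1` B `&` Y @^-1` C) = (P (X @^-1` B) * P (Y @^-1` C))%E.

(* Independent coherent pairs live on varying probability spaces, so instead of
   forming their class we collect the values of E|X - Y|^k over it. *)
Definition coherent_indep_moments (R : realType) (k : nat) : set (\bar R) :=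
  [set m | exists (d : measure_display) (T : measurableType d)
             (P : probability T R) (X Y : {RV P >-> R}),
     [/\ coherent X Y, independent_RV X Y &
         m = ('E_P[fun w => (`|X w - Y w| ^+ k)%R])%E]].
Arguments coherent_indep_moments R k _ : clear implicits.

Definition simple_graph (V : finType) (e : rel V) : Prop :=
  symmetric e /\ irreflexive e.

Definition degree (V : finType) (e : rel V) (v : V) : nat := #|[pred w | e v w]|.

(* The vertex x_i is [inl i] and the vertex y_j is [inr j]. *)
Definition bipartite_graphs (n : nat) : set (rel ('I_n + 'I_n)%type) :=
  [set e | [/\ simple_graph e,
               forall i i' : 'I_n, ~~ e (inl i) (inl i') &
               forall j j' : 'I_n, ~~ e (inr j) (inr j')]].
Arguments bipartite_graphs n _ : clear implicits.

Definition degree_moment (R : realType) (k n : nat)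
    (e : rel ('I_n + 'I_n)%type) : R :=
  (n%:R ^+ (2 + k))^-1 *
  \sum_(i < n) \sum_(j < n)
    `|(degree e (inl i))%:R - (degree e (inr j))%:R| ^+ k.

(* Main.v *)
From HB Require Import structures.
Require Import Defs.
From mathcomp Require Import all_boot all_order all_algebra.
From mathcomp Require Import all_classical all_reals all_analysis.
From mathcomp Require Import measurable_realfun.
Import Order.TTheory GRing.Theory Num.Theory.
Import numFieldNormedType.Exports.
Local Open Scope classical_set_scope.
Local Open Scope ring_scope.

(** A bipartite graph yields an independent coherent pair: pick a row [i] and a column [j]
    independently and uniformly, let [A] be the event that [x_i y_j] is an edge, and condition
    on [i] and on [j]; the pair is [(deg x_i / n, deg y_j / n)].

    Conversely, cut [[0, 1]] into [M] cells and record, for cells [a] and [b], the numbers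
    [p a = P(X in a)], [q b = P(Y in b)] and [m a b = P(A, X in a, Y in b) <= p a * q b]; up to
    an error [O(1/M)] the moment is a function of these, and [phi = m / (p q)] is a weighted
    bipartite graph with edge weights in [[0, 1]].  It is approximated by simple graphs: give
    the class [a] about [L p a] groups of [L] rows, likewise for columns, and join the [s]-th
    row of a group of class [a] to the [t]-th column of a group of class [b] when
    [s + t mod L < L phi a b].  Within a pair of groups every vertex then has the same
    degree [floor (L phi a b)].  Let [L], then [M], tend to infinity. *)

(** * The supremum over graphs, and relations between finite sets *)

Definition graph_sup (R : realType) (k : nat) : \bar R :=
  ereal_sup [set ereal_sup [set (degree_moment R k e)%:E
                           | e in bipartite_graphs n]
            | n in [set n : nat | (0 < n)%N]].

Lemma degree_moment_le_sup (R : realType) (k n : nat)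
    (e : rel ('I_n + 'I_n)%type) :
  (0 < n)%N -> bipartite_graphs n e -> ((degree_moment R k e)%:E <= graph_sup R k)%E.
Proof.
move=> n0 he; apply: (@le_trans _ _ (ereal_sup [set (degree_moment R k e)%:E
                           | e in bipartite_graphs n])).
  by apply: ereal_sup_ubound; exists e.
by apply: ereal_sup_ubound; exists n.
Qed.

Lemma ler_sum_inj (R : realDomainType) (S I : finType) (f : S -> I) (F : I -> R) :
  injective f -> (forall i, 0 <= F i) -> \sum_s F (f s) <= \sum_i F i.
Proof.
move=> fI F0; rewrite -(big_imset (h := f) (A := predT) F) /=; last by move=> ? ? _ _ /fI.
rewrite big_mkcond /=; apply: ler_sum => i _.
by case: ifP.
Qed.

(* Padding with isolated vertices. *)
Lemma relation_moment_le_sup (R : realType) (k n : nat) (S T : finType)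
    (r : S -> T -> bool) (dS : S -> nat) (dT : T -> nat) :
  (0 < n)%N -> (#|S| <= n)%N -> (#|T| <= n)%N ->
  (forall s, #|[pred t | r s t]| = dS s) ->
  (forall t, #|[pred s | r s t]| = dT t) ->
  ((((n%:R : R) ^+ (2 + k))^-1 *
    \sum_s \sum_t `|(dS s)%:R - (dT t)%:R| ^+ k)%:E
   <= graph_sup R k)%E.
Proof.
move=> n0 hS hT hdS hdT.
pose f (s : S) : 'I_n := widen_ord hS (enum_rank s).
pose g (t : T) : 'I_n := widen_ord hT (enum_rank t).
have fI : injective f by move=> x y /(congr1 val) /= /val_inj/enum_rank_inj.
have gI : injective g by move=> x y /(congr1 val) /= /val_inj/enum_rank_inj.
pose rho (i j : 'I_n) := [exists s, [exists t, [&& f s == i, g t == j & r s t]]].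
pose e (u v : 'I_n + 'I_n) := match u, v with
  | inl i, inr j => rho i j | inr j, inl i => rho i j | _, _ => false end.
have he : bipartite_graphs n e.
  by split=> //; split; [move=> [i|i] [j|j] | move=> [i|i]].
have degl s : degree e (inl (f s)) = dS s.
  have hI : injective (inr \o g : T -> 'I_n + 'I_n) by apply: inj_comp gI => ? ? [].
  rewrite -hdS -(fintype.card_image hI [pred t | r s t]).
  apply: eq_card => -[i|j]; rewrite inE /=.
    by symmetry; apply/fintype.imageP => -[? _].
  apply/existsP/fintype.imageP => [|[t /= rst [->]]].
    move=> [s' /existsP[t' /and3P[/eqP/fI -> /eqP <-]]] rst.
    by exists t'.
  by exists s; apply/existsP; exists t; rewrite !eqxx.
have degr t : degree e (inr (g t)) = dT t.
  have hI : injective (inl \o f : S -> 'I_n + 'I_n) by apply: inj_comp fI => ? ? [].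
  rewrite -hdT -(fintype.card_image hI [pred s | r s t]).
  apply: eq_card => -[j|i]; rewrite inE /=; last first.
    by symmetry; apply/fintype.imageP => -[? _].
  apply/existsP/fintype.imageP => [|[s /= rst [->]]].
    move=> [s' /existsP[t' /and3P[/eqP <- /eqP/gI ->]]] rst.
    by exists s'.
  by exists s; apply/existsP; exists t; rewrite !eqxx.
apply: le_trans (degree_moment_le_sup R k n e n0 he).
rewrite lee_fin ler_wpM2l ?invr_ge0 ?exprn_ge0//.
pose F i j : R := `|(degree e (inl i))%:R - (degree e (inr j))%:R| ^+ k.
(* Restricting the double sum to the images of [f] and [g] drops only nonnegative terms. *)
apply: (@le_trans _ _ (\sum_s \sum_j F (f s) j)).
  apply: ler_sum => s _; under eq_bigr do rewrite -degl -degr.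
  by apply: (ler_sum_inj _ _ _ g (F (f s)) gI) => j; rewrite exprn_ge0.
apply: (ler_sum_inj _ _ _ f (fun i => \sum_j F i j) fI) => i.
by apply: sumr_ge0 => j _; rewrite exprn_ge0.
Qed.

(** * Blow-ups of weighted bipartite graphs *)

(** The addition is that of the cyclic group on ['I_l.+1], so translation by [- a] carries the first
    [m] residues bijectively onto the set counted. *)
Lemma card_shifted_below (l m : nat) (a : 'I_l.+1) :
  (m <= l.+1)%N -> #|[pred b : 'I_l.+1 | ((a + b)%R < m)%N]| = m.
Proof.
move=> ml; rewrite -[RHS]card_ord.
have fI : injective (fun i : 'I_m => (- a + widen_ord ml i)%R).
  by move=> x y /addrI/(congr1 val) /= /val_inj.
rewrite -[RHS](fintype.card_image fI); apply: eq_card => b; rewrite !inE.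
apply/idP/fintype.imageP => [h|[i _ ->]]; last by rewrite addNKr /=.
by exists (Ordinal h) => //; rewrite [widen_ord _ _](_ : _ = a + b) ?addKr//; apply: val_inj.
Qed.

Lemma sum_tag (R : nmodType) (I : finType) (nu : I -> nat) (F : I -> R) :
  \sum_(x : {i : I & 'I_(nu i)}) F (tag x) = \sum_i F i *+ nu i.
Proof.
rewrite -(@sig_big_dep _ _ _ I (fun i => 'I_(nu i)) xpredT (fun=> xpredT) (fun i _ => F i)) /=.
by apply: eq_bigr => i _; rewrite sumr_const card_ord.
Qed.

(** A vertex consists of a class, one of the [nu i] groups of that class, and a position inside the
    group. *)
Definition blowup (I : finType) (nu : I -> nat) (l : nat) : Type :=
  ({i : I & 'I_(nu i)} * 'I_l)%type.
HB.instance Definition _ (I : finType) (nu : I -> nat) (l : nat) :=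
  Finite.on (blowup I nu l).

Lemma card_blowup_type (I : finType) (nu : I -> nat) (l : nat) :
  #|{: blowup I nu l}| = ((\sum_i nu i) * l)%N.
Proof.
rewrite card_prod card_tagged card_ord sumnE big_map big_enum /=.
by under eq_bigr do rewrite card_ord.
Qed.

Lemma sum_blowup (R : nmodType) (I : finType) (nu : I -> nat) (l : nat) (F : I -> R) :
  \sum_(x : blowup I nu l) F (tag x.1) = \sum_i F i *+ nu i *+ l.
Proof.
transitivity (\sum_(x : {i : I & 'I_(nu i)}) \sum_(a : 'I_l) F (tag x)).
  by rewrite pair_bigA.
rewrite (sum_tag R I nu (fun i => \sum_(a : 'I_l) F i)); apply: eq_bigr => i _.
by rewrite sumr_const card_ord -!mulrnA mulnC.
Qed.

(** Each group of class [j] contributes [m j] neighbours whatever the position [a]; hence the degree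
    of a vertex depends on its class alone. *)
Lemma card_blowup (J : finType) (nu m : J -> nat) (l : nat) (a : 'I_l.+1) :
  (forall j, (m j <= l.+1)%N) ->
  #|[pred t : blowup J nu l.+1 | ((a + t.2)%R < m (tag t.1))%N]|
  = (\sum_j nu j * m j)%N.
Proof.
move=> hm; rewrite -sum1_card big_mkcond /=.
rewrite -(pair_bigA _ (fun t b => if ((a + b)%R < m (tag t))%N then 1%N else 0%N)) /=.
transitivity (\sum_(t : {j : J & 'I_(nu j)}) m (tag t))%N.
  apply: eq_bigr => t _; rewrite -[RHS](card_shifted_below l _ a (hm (tag t))).
  by rewrite -sum1_card [RHS]big_mkcond.
rewrite (sum_tag nat _ nu m); apply: eq_bigr => j _.
by rewrite mulnC; elim: (nu j) => [|u ih]; rewrite ?mulr0n ?muln0// mulrS ih mulnS.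
Qed.

(** With [L = l.+1], the graph has [n = L * L] vertices on each side after padding. Class [i] fills
    the proportion [nu i / L] of them, and a degree divided by [n] is the sum of the products of
    [nu' j / L] and [m i j / L]. *)
Lemma blowup_moment_le_sup (R : realType) (k l : nat) (I J : finType)
    (nu : I -> nat) (nu' : J -> nat) (m : I -> J -> nat) :
  (\sum_i nu i <= l.+1)%N -> (\sum_j nu' j <= l.+1)%N ->
  (forall i j, m i j <= l.+1)%N ->
  ((\sum_i \sum_j ((nu i)%:R / l.+1%:R) * ((nu' j)%:R / l.+1%:R) *
     `|\sum_j' ((nu' j')%:R / l.+1%:R) * ((m i j')%:R / l.+1%:R)
       - \sum_i' ((nu i')%:R / l.+1%:R) * ((m i' j)%:R / l.+1%:R) : R| ^+ k)%:E
   <= graph_sup R k)%E.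
Proof.
move=> hnu hnu' hm; set L : R := l.+1%:R.
have L0 : 0 < L by rewrite ltr0n.
pose S := blowup I nu l.+1; pose T := blowup J nu' l.+1.
pose r (s : S) (t : T) := ((s.2 + t.2)%R < m (tag s.1) (tag t.1))%N.
have hS : (#|{: S}| <= l.+1 * l.+1)%N by rewrite card_blowup_type leq_mul2r.
have hT : (#|{: T}| <= l.+1 * l.+1)%N by rewrite card_blowup_type leq_mul2r.
have degl s : #|[pred t | r s t]| = (\sum_j nu' j * m (tag s.1) j)%N.
  exact: (card_blowup J nu' (m (tag s.1)) l s.2).
have degr t : #|[pred s | r s t]| = (\sum_i nu i * m i (tag t.1))%N.
  (* The joining rule involves the positions only through their sum, so columns are counted like
     rows. *)
  rewrite -(card_blowup I nu (m ^~ (tag t.1)) l t.2)//.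
  by apply: eq_card => s; rewrite !inE /r addrC.
apply: le_trans (relation_moment_le_sup R k (l.+1 * l.+1)
  (blowup I nu l.+1) (blowup J nu' l.+1) r _ _ isT hS hT degl degr).
rewrite lee_fin.
pose D i j : R := `|(\sum_j' nu' j' * m i j')%:R - (\sum_i' nu i' * m i' j)%:R| ^+ k.
have -> : \sum_(s : blowup I nu l.+1) \sum_(t : blowup J nu' l.+1)
    `|(\sum_j nu' j * m (tag s.1) j)%:R
      - (\sum_i nu i * m i (tag t.1))%:R : R| ^+ k =
    \sum_i \sum_j D i j * ((nu' j)%:R * L) * ((nu i)%:R * L).
  transitivity (\sum_i (\sum_j D i j *+ nu' j *+ l.+1) *+ nu i *+ l.+1); last first.
    apply: eq_bigr => i _; rewrite -mulrnA -[_ *+ (nu i * l.+1)]mulr_natr natrM mulr_suml.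
    by apply: eq_bigr => j _; rewrite -mulrnA -[_ *+ (nu' j * l.+1)]mulr_natr natrM.
  etransitivity; last exact: (sum_blowup R I nu l.+1 (fun i => \sum_j D i j *+ nu' j *+ l.+1)).
  apply: eq_bigr => s _; etransitivity; last exact: (sum_blowup R J nu' l.+1 (D (tag s.1))).
  by [].
rewrite mulr_sumr; apply: ler_sum => i _; rewrite mulr_sumr.
apply: ler_sum => j _; rewrite natrM -/L.
rewrite /D !natr_sum.
have e (K : finType) (u v : K -> nat) :
    \sum_x ((u x)%:R / L) * ((v x)%:R / L) = (\sum_x (u x * v x)%:R) / (L * L).
  by rewrite mulr_suml; apply: eq_bigr => x _; rewrite natrM mulrACA -invfM.
rewrite !e -mulrBl normrM normrV ?unitfE ?mulf_neq0 ?gt_eqF// normrM (gtr0_norm L0).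
rewrite exprMn exprVn exprD expr2.
set Y := (L * L) ^+ k; set Z := `|_| ^+ k.
set a := (nu i)%:R; set b := (nu' j)%:R; rewrite !invfM.
(* Of the four factors [L^-1] in [n^-2], two cancel the group sizes and two turn [a] and [b] into
   proportions. *)
rewrite [leRHS](_ : _ = (L^-1 * L) * (L^-1 * L) * (a / L * (b / L) * (Z * Y^-1))).
  by rewrite mulVf ?gt_eqF// !mul1r.
by rewrite !mulrA [LHS](ACl (1*8*2*10*9*3*7*4*6*5)).
Qed.

(** * Rounding real weights *)

(** Rounding down loses less than one unit out of [l.+1], so the ratio lies between [x - harmonic l]
    and [x]. *)
Lemma cvg_truncn_ratio (R : realType) (x : R) : 0 <= x ->
  (Num.truncn (l.+1%:R * x))%:R / l.+1%:R @[l --> \oo] --> x.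
Proof.
move=> x0; apply: (@squeeze_cvgr _ _ _ _ (fun l => x - harmonic l) (cst x)); last 2 first.
- by rewrite -[X in _ --> X]subr0; apply: cvgB; [exact: cvg_cst|exact: cvg_harmonic].
- exact: cvg_cst.
apply: nearW => l; rewrite /harmonic /cst /=.
have L0 : 0 < l.+1%:R :> R by rewrite ltr0n.
have /andP[h1 h2] := truncn_itv (mulr_ge0 (ltW L0) x0).
rewrite ler_pdivlMr// ler_pdivrMr// mulrBl mulVf ?gt_eqF// mulrC h1 andbT.
by rewrite lerBlDr natr1 ltW.
Qed.

Lemma sum_truncn_le (R : realType) (I : finType) (p : I -> R) (l : nat) :
  (forall i, 0 <= p i) -> \sum_i p i <= 1 ->
  (\sum_i Num.truncn (l.+1%:R * p i) <= l.+1)%N.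
Proof.
move=> p0 p1; rewrite -(ler_nat R) natr_sum.
apply: (@le_trans _ _ (\sum_i (l.+1%:R * p i))).
  by apply: ler_sum => i _; rewrite truncn_le mulr_ge0.
by rewrite -mulr_sumr ler_piMr.
Qed.

(** Rounding all weights down at scale [l.+1] keeps the total masses at most 1, so the blow-up bound
    applies for every [l]. The moment depends continuously on finitely many weights, and the bound
    passes to the limit. *)
Lemma fractional_moment_le_sup (R : realType) (k : nat) (I J : finType)
    (p : I -> R) (q : J -> R) (phi : I -> J -> R) :
  (forall i, 0 <= p i) -> (forall j, 0 <= q j) ->
  \sum_i p i <= 1 -> \sum_j q j <= 1 ->
  (forall i j, 0 <= phi i j <= 1) ->
  ((\sum_i \sum_j p i * q j *
     `|\sum_j' q j' * phi i j' - \sum_i' p i' * phi i' j| ^+ k)%:E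
   <= graph_sup R k)%E.
Proof.
move=> p0 q0 p1 q1 hphi.
pose rho (x : R) l : R := (Num.truncn (l.+1%:R * x))%:R / l.+1%:R.
pose u l := \sum_i \sum_j rho (p i) l * rho (q j) l *
  `|\sum_j' rho (q j') l * rho (phi i j') l - \sum_i' rho (p i') l * rho (phi i' j) l| ^+ k.
have sum_cvg (K : finType) (f : K -> nat -> R) (a : K -> R) :
    (forall i, f i l @[l --> \oo] --> a i) ->
    \sum_i f i l @[l --> \oo] --> \sum_i a i.
  by move=> h; apply: cvg_big => //; exact: add_continuous.
have rho_cvg x : 0 <= x -> rho x l @[l --> \oo] --> x by exact: cvg_truncn_ratio.
have phi0 i j : 0 <= phi i j by case/andP: (hphi i j).
have cu : u l @[l --> \oo] --> \sum_i \sum_j p i * q j *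
     `|\sum_j' q j' * phi i j' - \sum_i' p i' * phi i' j| ^+ k.
  apply: (sum_cvg) => i; apply: (sum_cvg) => j; apply: cvgM.
    by apply: cvgM; exact: rho_cvg.
  apply: (cvg_comp _ (fun x : R => x ^+ k)); last exact: exprn_continuous.
  apply: cvg_norm; apply: cvgB; apply: (sum_cvg) => x; apply: cvgM; exact: rho_cvg.
have /cvge_to_le : EFin \o u @ \oo --> (\sum_i \sum_j p i * q j *
     `|\sum_j' q j' * phi i j' - \sum_i' p i' * phi i' j| ^+ k)%:E.
  by apply: cvg_EFin => //; exact: nearW.
apply; apply: nearW => l.
apply: (blowup_moment_le_sup R k l I J (fun i => Num.truncn (l.+1%:R * p i))
  (fun j => Num.truncn (l.+1%:R * q j)) (fun i j => Num.truncn (l.+1%:R * phi i j))).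
- exact: sum_truncn_le.
- exact: sum_truncn_le.
move=> i j; rewrite -(ler_nat R); case/andP: (hphi i j) => h0 h1.
by apply: (@le_trans _ _ (l.+1%:R * phi i j)); rewrite ?truncn_le ?mulr_ge0// ler_piMr.
Qed.

(** * Moments of distributions on a grid *)

(** The [k]-th power is [k]-Lipschitz on [[0, 1]], by induction on [k]. If [t > 1], then
    [s ^+ k <= 1 <= t ^+ k], so [t] needs no upper bound. *)
Lemma exprn_le_add (R : realDomainType) (k : nat) (s t e : R) :
  0 <= s <= 1 -> 0 <= t -> 0 <= e -> s <= t + e -> s ^+ k <= t ^+ k + k%:R * e.
Proof.
move=> /andP[s0 s1] t0 e0 ste; have [t1|/ltW t1] := leP t 1; last first.
  rewrite (@le_trans _ _ 1)// ?exprn_ile1//.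
  by rewrite ler_wpDr ?mulr_ge0// exprn_ege1.
elim: k => [|k ih]; first by rewrite !expr0 mul0r addr0.
rewrite !exprS; apply: (@le_trans _ _ (s * t ^+ k + k%:R * e)).
  apply: (le_trans (ler_wpM2l s0 ih)); rewrite mulrDr lerD2l ler_piMl// mulr_ge0//.
rewrite -natr1 mulrDl mul1r [_ * e + e]addrC addrA lerD2r.
apply: (le_trans (ler_wpM2r (exprn_ge0 k t0) ste)).
by rewrite mulrDl lerD2l ler_piMr// exprn_ile1.
Qed.

(** The error is [e] and not [2 * e]: [(x - y) - (a - b)] is the difference of [x - a] and [y - b],
    which both lie in [[0, e]]. *)
Lemma ler_dist_itv (R : realDomainType) (a b x y e : R) :
  a <= x <= a + e -> b <= y <= b + e ->
  `|a - b| <= `|x - y| + e /\ `|x - y| <= `|a - b| + e.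
Proof.
move=> /andP[ax xa] /andP[yl yu].
have h : `|(x - y) - (a - b)| <= e.
  have -> : (x - y) - (a - b) = (x - a) - (y - b).
    by rewrite !opprB addrACA [RHS]addrACA [- y - a]addrC.
  have xe : x - a <= e by rewrite lerBlDl.
  have ye : y - b <= e by rewrite lerBlDl.
  have x0 : 0 <= x - a by rewrite subr_ge0.
  have y0 : 0 <= y - b by rewrite subr_ge0.
  rewrite ler_norml; apply/andP; split.
    by rewrite lerBrDr addrC (le_trans _ x0)// subr_le0.
  by rewrite lerBlDr (le_trans xe)// lerDl.
split; rewrite -lerBlDl.
  by apply: (le_trans (lerB_dist _ _)); rewrite distrC.
by apply: le_trans h; exact: lerB_dist.
Qed.

(* [phi a b] is the conditional probability of the event given the two cells,
   with the junk value [0] on null cells. *)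
Lemma grid_moment_le_sup (R : realType) (k M : nat) (p q : 'I_M.+1 -> R)
    (m : 'I_M.+1 -> 'I_M.+1 -> R) :
  (0 < M)%N -> (forall a, 0 <= p a) -> (forall b, 0 <= q b) ->
  \sum_a p a <= 1 -> \sum_b q b <= 1 ->
  (forall a b, 0 <= m a b <= p a * q b) ->
  (forall a : 'I_M.+1, a%:R / M%:R * p a <= \sum_b m a b <= (a%:R / M%:R + M%:R^-1) * p a) ->
  (forall b : 'I_M.+1, b%:R / M%:R * q b <= \sum_a m a b <= (b%:R / M%:R + M%:R^-1) * q b) ->
  ((\sum_(a < M.+1) \sum_(b < M.+1) p a * q b *
      (`|a%:R / M%:R - b%:R / M%:R| ^+ k + k%:R / M%:R))%:E
   <= graph_sup R k + ((2 * k)%:R / M%:R)%:E)%E.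
Proof.
move=> M0 p0 q0 p1 q1 hm hp hq.
pose phi a b := m a b / (p a * q b).
have phi01 a b : 0 <= phi a b <= 1.
  have /andP[m0 m1] := hm a b; rewrite /phi divr_ge0 ?mulr_ge0//=.
  have := mulr_ge0 (p0 a) (q0 b); rewrite le_eqVlt => /predU1P[<-|pq0].
    by rewrite invr0 mulr0.
  by rewrite ler_pdivrMr// mul1r.
(* These are the weighted degrees. Where [p a > 0], [x a] is the row sum of [m] divided by [p a],
   which [hp] puts within [M^-1] above the grid point; likewise for [y b] and [hq]. *)
pose x a := \sum_b q b * phi a b; pose y b := \sum_a p a * phi a b.
have qphi a b : 0 < p a -> q b * phi a b = m a b / p a.
  (* If [q b = 0], the bound [m a b <= p a * q b] forces [m a b = 0], and both sides vanish. *)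
  move=> pa; rewrite /phi; have [qb|qb] := eqVneq (q b) 0.
    have := hm a b; rewrite qb mulr0 mul0r => /le_anti <-.
    by rewrite mul0r.
  by rewrite invfM mulrC -!mulrA mulVf// mulr1.
have pphi a b : 0 < q b -> p a * phi a b = m a b / q b.
  move=> qb; rewrite /phi; have [pa|pa] := eqVneq (p a) 0.
    have := hm a b; rewrite pa !mul0r => /le_anti <-.
    by rewrite mul0r.
  by rewrite [p a * q b]mulrC invfM mulrC -!mulrA mulVf// mulr1.
have hx (a : 'I_M.+1) : 0 < p a -> a%:R / M%:R <= x a <= a%:R / M%:R + M%:R^-1.
  move=> pa; rewrite /x; under eq_bigr => b _ do rewrite (qphi a b pa).
  by rewrite -mulr_suml ler_pdivlMr// ler_pdivrMr.
have hy (b : 'I_M.+1) : 0 < q b -> b%:R / M%:R <= y b <= b%:R / M%:R + M%:R^-1.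
  move=> qb; rewrite /y; under eq_bigr => a _ do rewrite (pphi a b qb).
  by rewrite -mulr_suml ler_pdivlMr// ler_pdivrMr.
(* One [k / M] is already in the summand, the other pays for replacing grid points by [x a] and
   [y b]; the total weight is at most 1. *)
apply: (@le_trans _ _ ((\sum_a \sum_b p a * q b * `|x a - y b| ^+ k)%:E
   + ((2 * k)%:R / M%:R)%:E)%E); last first.
  by rewrite leeD2r//; exact: (fractional_moment_le_sup R k _ _ p q phi).
rewrite -EFinD lee_fin.
have pq1 : \sum_a \sum_b p a * q b <= 1.
  under eq_bigr => a _ do rewrite -mulr_sumr.
  by rewrite -mulr_suml mulr_ile1// sumr_ge0.
have e0 : 0 <= M%:R^-1 :> R by rewrite invr_ge0.
apply: (@le_trans _ _ (\sum_a \sum_b p a * q b * `|x a - y b| ^+ k +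
   (\sum_a \sum_b p a * q b) * ((2 * k)%:R / M%:R))); last first.
  by rewrite lerD2l ler_piMl// mulr_ge0.
rewrite mulr_suml -big_split /=; apply: ler_sum => a _.
rewrite mulr_suml -big_split /=; apply: ler_sum => b _.
have [pa0|pa0] := eqVneq (p a) 0; first by rewrite pa0 !mul0r addr0.
have [qb0|qb0] := eqVneq (q b) 0; first by rewrite qb0 !(mulr0, mul0r) addr0.
have pa : 0 < p a by rewrite lt_def pa0 p0.
have qb : 0 < q b by rewrite lt_def qb0 q0.
rewrite -mulrDr ler_wpM2l ?mulr_ge0//.
rewrite mul2n -addnn natrD mulrDl addrA lerD2r.
have MR : 0 < M%:R :> R by rewrite ltr0n.
have c01 (c : 'I_M.+1) : 0 <= c%:R / M%:R :> R by rewrite mulr_ge0.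
have c1 (c : 'I_M.+1) : c%:R / M%:R <= 1 :> R.
  by rewrite ler_pdivrMr// mul1r ler_nat -ltnS.
apply: exprn_le_add => //.
- rewrite normr_ge0 ler_norml /=; apply/andP; split.
    by rewrite lerBrDr addrC (le_trans _ (c01 a))// subr_le0.
  by rewrite lerBlDr (le_trans (c1 a))// lerDl.
- by have [] := ler_dist_itv R _ _ _ _ _ (hx a pa) (hy b qb).
Qed.

(** * Partition of the real line into cells *)

(** Every real receives an index: for [M > 0], negative numbers fall into cell 0 and all [x >= 1]
    into cell [M]. The [M.+1] cells thus also cover values outside [[0, 1]]. *)
Definition grid_index (R : realType) (M : nat) (x : R) : nat :=
  minn M (Num.truncn (M%:R * x)).

Definition cell (R : realType) (M a : nat) : set R :=
  [set x | grid_index R M x = a].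

Lemma measurable_cell (R : realType) (M a : nat) : measurable (cell R M a).
Proof.
have mf : measurable_fun setT (fun x : R => (grid_index R M x)%:R : R).
  apply: nondecreasing_measurable => // x y xy.
  by rewrite ler_nat leq_min geq_minl (leq_trans (geq_minr _ _))// le_truncn// ler_wpM2l.
rewrite (_ : cell R M a = setT `&` (fun x : R => (grid_index R M x)%:R : R) @^-1` [set a%:R]).
  exact: mf.
by rewrite setTI; apply/seteqP; split => [x /= ->//|x /= /eqP]; rewrite eqr_nat => /eqP.
Qed.

(** Cell 0 is excluded because it contains the negative numbers. *)
Lemma cell_lower (R : realType) (M a : nat) (x : R) :
  (0 < a)%N -> cell R M a x -> a%:R / M%:R <= x.
Proof.
rewrite /cell /= /grid_index; case: a => // a _ xa.
have aM : (a.+1 <= M)%N by rewrite -xa geq_minl.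
have M0 : 0 < M%:R :> R by rewrite ltr0n (leq_trans _ aM).
by rewrite ler_pdivrMr// mulrC -truncn_gt_nat -xa geq_minr.
Qed.

(** Cell [M] is excluded because it is unbounded above. *)
Lemma cell_upper (R : realType) (M a : nat) (x : R) :
  (a < M)%N -> cell R M a x -> x <= a%:R / M%:R + M%:R^-1.
Proof.
rewrite /cell /= /grid_index => aM xa.
have M0 : 0 < M%:R :> R by rewrite ltr0n (leq_trans _ aM).
rewrite -[X in _ <= _ + X]mul1r -mulrDl natr1 ler_pdivlMr// mulrC ltW// -truncn_le_nat.
by move: xa; rewrite /minn; case: ifP => [_ MA|_ ->//]; rewrite MA ltnn in aM.
Qed.

Lemma cell_itv (R : realType) (M a : nat) (x : R) : (0 < M)%N ->
  0 <= x <= 1 -> cell R M a x -> a%:R / M%:R <= x <= a%:R / M%:R + M%:R^-1.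
Proof.
move=> M0 /andP[x0 x1] xa.
have aM : (a <= M)%N by rewrite -xa geq_minl.
have MR : 0 < M%:R :> R by rewrite ltr0n.
apply/andP; split.
  by case: a xa {aM} => [|a] xa; [rewrite mul0r | exact: cell_lower].
move: aM; rewrite leq_eqVlt => /predU1P[->|aM]; last exact: cell_upper.
by rewrite divff ?gt_eqF// (le_trans x1)// lerDl invr_ge0 ltW.
Qed.

Lemma grid_index_lt (R : realType) (M : nat) (x : R) : (grid_index R M x < M.+1)%N.
Proof. by rewrite ltnS geq_minl. Qed.

(** * Conditional probabilities on cells *)

Section cells.
Context d (T : measurableType d) (R : realType) (P : probability T R).
Variable M : nat.

Lemma prob_sum_cells (E : set T) (X : T -> R) :
  measurable E -> measurable_fun setT X ->
  P E = (\sum_(a < M.+1) P (E `&` X @^-1` cell R M a))%E.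
Proof.
move=> mE mX; rewrite -(measure_bigsetU_ord P predT).
- congr (P _); rewrite -bigcup_seq; apply/seteqP; split => [w Ew|w [a _ []//]].
  exists (Ordinal (grid_index_lt R M (X w))) => //=.
  by rewrite mem_index_enum.
- move=> a; apply: measurableI => //; rewrite -[_ @^-1` _]setTI.
  by apply: mX => //; exact: measurable_cell.
- move=> a b _ _ [w [[_ /= wa] [_ /= wb]]]; apply/val_inj => /=.
  by rewrite -wa -wb.
Qed.

(** On [E] the integral of the absolute value of [f] is minus that of [f], hence zero; so [f]
    vanishes almost everywhere on [E], where it is negative. *)
Lemma ae_notin_integral_ge0 (E : set T) (f : T -> R) :
  measurable E -> P.-integrable setT (EFin \o f) -> (forall w, E w -> f w < 0) ->
  (0 <= \int[P]_(w in E) (f w)%:E)%E -> {ae P, forall w, ~ E w}.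
Proof.
move=> mE intf f0 If.
have intE : P.-integrable E (EFin \o f) by exact: integrableS intf.
have mf : measurable_fun E (EFin \o f) by case/integrableP: intE.
have : (\int[P]_(w in E) `|(f w)%:E| = 0)%E.
  apply/eqP; rewrite eq_le integral_ge0// andbT.
  rewrite (eq_integral (fun w => (- (f w)%:E)%E)); last first.
    by move=> w /set_mem /f0 fw; rewrite /= ltr0_norm// ltW.
  rewrite integralN ?oppe_le0//; exact: integrable_add_def.
move/(ae_eq_integral_abs P mE mf).1.
apply: filterS => w h Ew; have := f0 w Ew.
by have [->] := h Ew; rewrite ltxx.
Qed.
End cells.

Section cond_prob.
Context d (T : measurableType d) (R : realType) (P : probability T R).
Variables (A : set T) (G : set (set T)) (X : T -> R).
Hypotheses (mA : measurable A) (hG : sub_sigma_field G) (hX : is_cond_prob P A G X).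

Lemma cond_prob_measurable_preimage (B : set R) :
  measurable B -> measurable (X @^-1` B).
Proof. by case: hX => + _ _ mB; move=> /(_ _ mB); exact: hG.2. Qed.

Lemma cond_prob_integral (B : set R) : measurable B ->
  (\int[P]_(w in X @^-1` B) (X w)%:E = P (A `&` X @^-1` B))%E.
Proof. by case: hX => GX _ IX mB; exact/IX/GX. Qed.

Lemma cond_prob_integral_le (B : set R) (u : R) : measurable B ->
  (forall x, B x -> x <= u) ->
  (\int[P]_(w in X @^-1` B) (X w)%:E <= u%:E * P (X @^-1` B))%E.
Proof.
move=> mB Bu; have mE := cond_prob_measurable_preimage _ mB.
rewrite -integral_cst//; apply: le_integral => //.
- by case: hX => _ iX _; exact: integrableS iX.
- exact: finite_measure_integrable_cst.
- by move=> w /set_mem /= /Bu; rewrite lee_fin.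
Qed.

Lemma cond_prob_integral_ge (B : set R) (l : R) : measurable B ->
  (forall x, B x -> l <= x) ->
  (l%:E * P (X @^-1` B) <= \int[P]_(w in X @^-1` B) (X w)%:E)%E.
Proof.
move=> mB Bl; have mE := cond_prob_measurable_preimage _ mB.
rewrite -integral_cst//; apply: le_integral => //.
- exact: finite_measure_integrable_cst.
- by case: hX => _ iX _; exact: integrableS iX.
- by move=> w /set_mem /= /Bl; rewrite lee_fin.
Qed.

(** On [E = {X < 0}] the integral of [X] is [P (A & E) >= 0]; on [E = {X > 1}] that of [1 - X] is
    [P E - P (A & E) >= 0]. Both events are therefore null. *)
Lemma cond_prob_ae_itv : {ae P, forall w, 0 <= X w <= 1}.
Proof.
have [_ iX _] := hX.
have h0 : {ae P, forall w, ~ (X @^-1` [set x | x < 0]) w}.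
  have mB : measurable [set x : R | x < 0] by rewrite -set_itvNyo.
  apply: (ae_notin_integral_ge0 _ _ _ P _ X) => //.
    exact: cond_prob_measurable_preimage.
  by rewrite cond_prob_integral.
have h1 : {ae P, forall w, ~ (X @^-1` [set x | 1 < x]) w}.
  have mB : measurable [set x : R | 1 < x] by rewrite -set_itvoy.
  have mE := cond_prob_measurable_preimage _ mB.
  have i1 : P.-integrable setT (EFin \o cst 1) by exact: finite_measure_integrable_cst.
  apply: (ae_notin_integral_ge0 _ _ _ P _ (fun w => 1 - X w)) => //.
  - exact: (integrableB measurableT i1 iX).
  - by move=> w /= X1; rewrite subr_lt0.
  under eq_integral do rewrite EFinB.
  rewrite (integralB_EFin mE (f1 := cst 1)); [|exact: integrableS i1|exact: integrableS iX].
  rewrite (integral_cst P mE 1%E) mul1e cond_prob_integral// sube_ge0 ?fin_num_measure//.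
    by apply: le_measure => //; rewrite inE//; exact: measurableI.
  exact: measurableI.
move: h0 h1; apply: filterS2 => w /negP + /negP; rewrite -!leNgt => -> ->.
by [].
Qed.

(** Integrating the bounds of the cell gives all but two cases: for [a = 0] the lower bound is
    nonnegativity, and for [a = M] the upper one is monotonicity of [P], as [M / M = 1]. *)
Lemma cond_prob_cell (M a : nat) : (0 < M)%N -> (a <= M)%N ->
  a%:R / M%:R * fine (P (X @^-1` cell R M a)) <= fine (P (A `&` X @^-1` cell R M a))
    <= (a%:R / M%:R + M%:R^-1) * fine (P (X @^-1` cell R M a)).
Proof.
move=> M0 aM; have mB := measurable_cell R M a.
have mE := cond_prob_measurable_preimage _ mB.
have mAE : measurable (A `&` X @^-1` cell R M a) by exact: measurableI.
rewrite -!lee_fin !(EFinM _ (fine _)) !fineK ?fin_num_measure//; apply/andP; split.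
  case: a aM mB mE {mAE} => [|a] aM mB mE; first by rewrite mulr0n mul0r mul0e.
  by rewrite -cond_prob_integral//; apply: cond_prob_integral_ge => // x; exact: cell_lower.
move: aM; rewrite leq_eqVlt => /predU1P[aM|aM].
  subst M; rewrite divff ?pnatr_eq0 ?lt0n_neq0//.
  apply: (@le_trans _ _ (P (X @^-1` cell R a a))).
    by apply: le_measure => //; rewrite inE.
  by rewrite lee_pemull// lee_fin lerDl invr_ge0.
rewrite -cond_prob_integral//; apply: cond_prob_integral_le => // x.
exact: cell_upper.
Qed.

End cond_prob.

(** * Upper bound for coherent pairs *)

(** Almost everywhere the integrand is at most a step function, constant on pairs of cells; by
    independence its integral is the sum in [grid_moment_le_sup]. *)
Lemma coherent_moment_le_grid (d : measure_display) (T : measurableType d)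
    (R : realType) (P : probability T R) (X Y : {RV P >-> R}) (k M : nat) :
  (0 < M)%N -> coherent X Y -> independent_RV X Y ->
  ('E_P[fun w => (`|X w - Y w| ^+ k)%R] <= graph_sup R k + ((2 * k)%:R / M%:R)%:E)%E.
Proof.
move=> M0 [A [G [H [mA hG hH hX hY]]]] XY.
have mX : measurable_fun setT X by exact: measurable_funPT.
have mY : measurable_fun setT Y by exact: measurable_funPT.
pose S (a : 'I_M.+1) := X @^-1` cell R M a.
pose U (b : 'I_M.+1) := Y @^-1` cell R M b.
have mS a : measurable (S a).
  exact: (cond_prob_measurable_preimage _ _ _ _ _ _ _ hG hX _ (measurable_cell R M a)).
have mU b : measurable (U b).
  exact: (cond_prob_measurable_preimage _ _ _ _ _ _ _ hH hY _ (measurable_cell R M b)).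
pose p a := fine (P (S a)); pose q b := fine (P (U b)).
pose m a b := fine (P (A `&` S a `&` U b)).
have mAS a : measurable (A `&` S a) by exact: measurableI.
have mSU a b : measurable (S a `&` U b) by exact: measurableI.
have mASU a b : measurable (A `&` S a `&` U b) by exact: measurableI.
have fin E : measurable E -> P E \is a fin_num by move=> mE; exact: fin_num_measure.
have PSU a b : fine (P (S a `&` U b)) = p a * q b.
  rewrite /S /U XY; [|exact: measurable_cell..].
  by rewrite fineM ?fin//; [exact: (mS a)|exact: (mU b)].
have sum1 (Z : T -> R) : measurable_fun setT Z ->
    (forall a : 'I_M.+1, measurable (Z @^-1` cell R M a)) ->
    \sum_(a < M.+1) fine (P (Z @^-1` cell R M a)) <= 1.
  move=> mZ mZa; rewrite -lee_fin -sumEFin.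
  rewrite -(probability_setT P) (prob_sum_cells _ _ _ P M setT Z)//.
  by apply: lee_sum => a _; rewrite setTI fineK ?fin.
have rowE a : \sum_b m a b = fine (P (A `&` S a)).
  rewrite (prob_sum_cells _ _ _ P M (A `&` S a) Y)// -sum_fine// => b _.
  exact: (fin _ (mASU a b)).
have colE b : \sum_a m a b = fine (P (A `&` U b)).
  have mAU : measurable (A `&` U b) by exact: measurableI.
  rewrite (prob_sum_cells _ _ _ P M (A `&` U b) X)// -sum_fine//; last first.
    by move=> a _; apply: fin; apply: measurableI => //; exact: mS.
  by apply: eq_bigr => a _; rewrite /m setIAC.
apply: le_trans (grid_moment_le_sup R k M p q m M0 _ _ _ _ _ _ _); first last.
- move=> b; rewrite colE; apply: (cond_prob_cell _ _ _ _ _ _ _ mA hH hY) => //.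
  by rewrite -ltnS.
- move=> a; rewrite rowE; apply: (cond_prob_cell _ _ _ _ _ _ _ mA hG hX) => //.
  by rewrite -ltnS.
- move=> a b; rewrite fine_ge0//= -PSU fine_le ?fin//.
  apply: le_measure; rewrite ?inE// -setIA; exact: subIsetr.
- exact: sum1.
- exact: sum1.
- by move=> b; rewrite fine_ge0.
- by move=> a; rewrite fine_ge0.
pose c (a b : 'I_M.+1) : R := `|a%:R / M%:R - b%:R / M%:R| ^+ k + k%:R / M%:R.
have c0 a b : 0 <= c a b by rewrite addr_ge0 ?exprn_ge0 ?divr_ge0.
have msum : measurable_fun setT
    (fun w => \sum_(a < M.+1) \sum_(b < M.+1) (c a b * \1_(S a `&` U b) w)%:E)%E.
  apply: emeasurable_sum => a; apply: emeasurable_sum => b.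
  apply/measurable_EFinP; apply: measurable_funM => //.
rewrite unlock.
apply: (@le_trans _ _ (\int[P]_w
    (\sum_(a < M.+1) \sum_(b < M.+1) (c a b * \1_(S a `&` U b) w)%:E)%E)%E).
  apply: ae_ge0_le_integral => //.
  - apply/measurable_EFinP; apply: measurable_funX.
    apply: measurableT_comp => //; exact: measurable_funB.
  - move=> w _; apply: sume_ge0 => a _; apply: sume_ge0 => b _.
    by rewrite lee_fin mulr_ge0.
  (* The comparison is only almost everywhere: in the extreme cells the grid point approximates [X]
     or [Y] only if these lie in [[0, 1]]. *)
  have X01 := cond_prob_ae_itv _ _ _ _ _ _ _ mA hG hX.
  have Y01 := cond_prob_ae_itv _ _ _ _ _ _ _ mA hH hY.
  move: X01 Y01; apply: filterS2 => w X01 Y01 _.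
  pose a : 'I_M.+1 := Ordinal (grid_index_lt R M (X w)).
  pose b : 'I_M.+1 := Ordinal (grid_index_lt R M (Y w)).
  have cg x y : (0 <= (c x y * \1_(S x `&` U y) w)%:E)%E by rewrite lee_fin mulr_ge0.
  have Sw : S a w by [].
  have Uw : U b w by [].
  (* Only the term of the cells containing [X w] and [Y w] is kept; the others are nonnegative. *)
  rewrite (bigD1 a)//=; apply: lee_paddr.
    by apply: sume_ge0 => i _; exact: sume_ge0.
  rewrite (bigD1 b)//=; apply: lee_paddr.
    exact: sume_ge0.
  rewrite indicE mem_set// mulr1 lee_fin.
  have [_ h] := ler_dist_itv R _ _ _ _ _
    (cell_itv R M a _ M0 X01 Sw) (cell_itv R M b _ M0 Y01 Uw).
  apply: exprn_le_add => //.
  move/andP: X01 => [X0 X1]; move/andP: Y01 => [Y0 Y1].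
  rewrite normr_ge0 ler_norml /=; apply/andP; split.
    by rewrite lerBrDr addrC (le_trans _ X0)// subr_le0.
  by rewrite lerBlDr (le_trans X1)// lerDl.
rewrite ge0_integral_sum//; first last.
- by move=> a w _; apply: sume_ge0 => b _; rewrite lee_fin mulr_ge0.
- move=> a; apply: emeasurable_sum => b.
  by apply/measurable_EFinP; apply: measurable_funM.
rewrite -sumEFin; apply: lee_sum => a _.
rewrite ge0_integral_sum//; first last.
- by move=> b w _; rewrite lee_fin mulr_ge0.
- by move=> b; apply/measurable_EFinP; apply: measurable_funM.
rewrite -sumEFin; apply: lee_sum => b _.
under eq_integral do rewrite EFinM.
rewrite ge0_integralZl//; last 2 first.
- exact/measurable_EFinP.
- exact: c0.
by rewrite integral_indic// setIT -PSU EFinM muleC fineK ?fin.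
Qed.

Lemma coherent_moment_le_sup (d : measure_display) (T : measurableType d)
    (R : realType) (P : probability T R) (X Y : {RV P >-> R}) (k : nat) :
  coherent X Y -> independent_RV X Y ->
  ('E_P[fun w => (`|X w - Y w| ^+ k)%R] <= graph_sup R k)%E.
Proof.
move=> cXY iXY; apply/lee_addgt0Pr => e e0.
(* Chosen so that [2 * k / M] is at most [e]. *)
pose M := (Num.truncn ((2 * k)%:R / e)).+1.
apply: (le_trans (coherent_moment_le_grid _ _ _ _ _ _ k M isT cXY iXY)).
rewrite leeD2l// lee_fin ler_pdivrMr ?ltr0n// mulrC -ler_pdivrMr//.
exact/ltW/truncnS_gt.
Qed.

(** * Conditional probabilities on finite uniform spaces *)

(* The uniform distribution on a finite type, carried by the codes of its elements in [nat]
   so as to live on a discrete measurable space. *)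
Lemma exists_uniform (R : realType) (I : finType) (i0 : I) :
  exists P : probability nat R,
    (forall E : set nat, P E = (#|I|%:R^-1 * \sum_(i : I) \1_E (pickle i))%:E) /\
    (forall (E : set nat) (f : nat -> R), (forall w, 0 <= f w) ->
       (\int[P]_(w in E) (f w)%:E)%E =
       (#|I|%:R^-1 * \sum_(i : I) f (pickle i) * \1_E (pickle i))%:E).
Proof.
have I0 : (0 < #|I|)%N by apply/card_gt0P; exists i0.
pose x (n : nat) := pickle (nth i0 (enum I) n).
have c0 : 0 <= #|I|%:R^-1 :> R by rewrite invr_ge0.
pose mu := mscale (NngNum c0) (msum (fun n => \d_(x n)) #|I|).
have sumx (F : nat -> R) : \sum_(n < #|I|) F (x n) = \sum_(i : I) F (pickle i).
  rewrite -[RHS]big_enum /= (big_nth i0) big_mkord -cardE.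
  by [].
have muE E : mu E = (#|I|%:R^-1 * \sum_(i : I) \1_E (pickle i))%:E.
  rewrite /mu /mscale /msum /= -(sumx (\1_E)) EFinM -sumEFin.
  by [].
have mu1 : mu setT = 1%E.
  rewrite muE; under eq_bigr do rewrite indicT.
  by rewrite sumr_const cardT -cardE mulVf // pnatr_eq0 -lt0n.
pose P : probability nat R := HB.pack (mu : set nat -> \bar R)
   (Measure.class mu) (Measure_isProbability.Build _ _ _ mu mu1).
exists P; split => [|E f f0]; first exact: muE.
transitivity (\int[mu]_(w in E) (f w)%:E)%E; first by [].
rewrite ge0_integral_mscale//; last by move=> w _; rewrite lee_fin.
rewrite ge0_integral_measure_sum//; last by move=> w _; rewrite lee_fin.
rewrite -(sumx (fun w => f w * \1_E w)) EFinM -sumEFin; congr (_ * _)%E.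
apply: eq_bigr => n _; rewrite integral_dirac// diracE EFinM muleC indicE.
by [].
Qed.

Section finite_space.
Context (R : realType) (I : finType) (P : probability nat R).
Hypothesis PE :
  forall E : set nat, P E = (#|I|%:R^-1 * \sum_(i : I) \1_E (pickle i))%:E.
Hypothesis intPE : forall (E : set nat) (f : nat -> R), (forall w, 0 <= f w) ->
  (\int[P]_(w in E) (f w)%:E)%E =
  (#|I|%:R^-1 * \sum_(i : I) f (pickle i) * \1_E (pickle i))%:E.
Variables (K : finType) (phi : I -> K) (v : K -> R) (A : pred I).

Definition coded (w : nat) : option I := unpickle w.

Definition coded_event : set nat := [set w | oapp A false (coded w)].

(** The sigma-field generated by [phi], as the unions of its fibres; the integers that decode to
    nothing form one more fibre, which is null. *)
Definition coded_field : set (set nat) :=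
  [set E | forall w w', omap phi (coded w) = omap phi (coded w') -> E w -> E w'].

Definition coded_fun (w : nat) : R := oapp v 0 (omap phi (coded w)).

Lemma coded_pickle (i : I) : coded (pickle i) = Some i.
Proof. exact: pickleK. Qed.

Lemma coded_fun_pickle (i : I) : coded_fun (pickle i) = v (phi i).
Proof. by rewrite /coded_fun coded_pickle. Qed.

Lemma coded_sub_sigma_field : sub_sigma_field coded_field.
Proof.
split => //; split.
- by [].
- move=> E hE w w' ww' [_ Ew]; split => // Ew'; apply: Ew.
  exact: hE (esym ww') Ew'.
- by move=> F hF w w' ww' [j _ Fw]; exists j => //; exact: hF ww' Fw.
Qed.

Hypothesis v0 : forall x, 0 <= v x.
(** This says that [v] after [phi] is the conditional probability of [A] given [phi], tested against
    functions of [phi]. *)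
Hypothesis vA : forall F : K -> R,
  \sum_i F (phi i) * v (phi i) = \sum_(i | A i) F (phi i).

Lemma coded_fun_ge0 (w : nat) : 0 <= coded_fun w.
Proof. by rewrite /coded_fun; case: (omap _ _) => /=. Qed.

Lemma coded_is_cond_prob : is_cond_prob P coded_event coded_field coded_fun.
Proof.
split.
- by move=> B _ w w' ww'; rewrite /= /coded_fun ww'.
- apply/integrableP; split; first by [].
  under eq_integral do rewrite /= ger0_norm ?coded_fun_ge0//.
  by rewrite intPE ?ltry//; exact: coded_fun_ge0.
move=> E hE; rewrite intPE; last exact: coded_fun_ge0.
rewrite PE; congr (_ * _)%:E.
(* The image of [E] under [phi]. As [E] is a union of fibres, its indicator at a code is that of [B]
   after [phi], an admissible test function in [vA]. *)
pose B := [set x | exists2 w, E w & omap phi (coded w) = Some x].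
have EB i : \1_E (pickle i) = \1_B (phi i) :> R.
  rewrite !indicE; congr (_%:R); congr nat_of_bool.
  apply/idP/idP; rewrite !inE.
    by exists (pickle i) => //; rewrite coded_pickle.
  by move=> [w Ew hw]; apply: (hE w) => //; rewrite coded_pickle.
transitivity (\sum_i \1_B (phi i) * v (phi i)).
  by apply: eq_bigr => i _; rewrite EB coded_fun_pickle mulrC.
rewrite vA big_mkcond; apply: eq_bigr => i _.
rewrite indicI /= -EB [in RHS]indicE.
have -> : (pickle i \in coded_event) = A i.
  by apply/idP/idP; rewrite inE /coded_event /= coded_pickle.
by case: (A i); rewrite (mul1r, mul0r).
Qed.

End finite_space.

(** * Coherent pairs built from graphs *)

Lemma degree_sum (V : finType) (e : rel V) (x : V) :
  degree e x = (\sum_y e x y)%N.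
Proof.
rewrite /degree -sum1_card big_mkcond; apply: eq_bigr => y _.
by rewrite inE; case: (e x y).
Qed.

Lemma degree_inl (n : nat) (e : rel ('I_n + 'I_n)%type) (i : 'I_n) :
  bipartite_graphs n e -> degree e (inl i) = (\sum_j e (inl i) (inr j))%N.
Proof.
move=> [_ he _]; rewrite degree_sum big_sumType /= big1 ?add0n// => j _.
by rewrite (negbTE (he i j)).
Qed.

Lemma degree_inr (n : nat) (e : rel ('I_n + 'I_n)%type) (j : 'I_n) :
  bipartite_graphs n e -> degree e (inr j) = (\sum_i e (inl i) (inr j))%N.
Proof.
move=> [[es _] _ he]; rewrite degree_sum big_sumType /= [X in (_ + X)%N]big1 ?addn0.
  by apply: eq_bigr => i _; rewrite es.
by move=> i _; rewrite (negbTE (he j i)).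
Qed.

Lemma degree_moment_coherent (R : realType) (k n : nat) (e : rel ('I_n + 'I_n)%type) :
  (0 < n)%N -> bipartite_graphs n e ->
  coherent_indep_moments R k (degree_moment R k e)%:E.
Proof.
case: n e => // n e _ he.
have [P [PE intPE]] := exists_uniform R _ ((ord0, ord0) : 'I_n.+1 * 'I_n.+1).
have N0 : n.+1%:R != 0 :> R by rewrite pnatr_eq0.
pose A : pred ('I_n.+1 * 'I_n.+1) := fun u => e (inl u.1) (inr u.2).
pose vx (i : 'I_n.+1) : R := (degree e (inl i))%:R / n.+1%:R.
pose vy (j : 'I_n.+1) : R := (degree e (inr j))%:R / n.+1%:R.
have vx0 i : 0 <= vx i by rewrite divr_ge0.
have vy0 j : 0 <= vy j by rewrite divr_ge0.
(* Row [i] of the square has [n.+1] points, of which the degree of [inl i] many lie in [A]; the row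
   length cancels the denominator of [vx i]. *)
have hx (F : 'I_n.+1 -> R) : \sum_(u : 'I_n.+1 * 'I_n.+1) F u.1 * vx u.1 = \sum_(u | A u) F u.1.
  rewrite [RHS]big_mkcond -(pair_bigA _ (fun i j => F i * vx i)).
  rewrite -(pair_bigA _ (fun i j => if e (inl i) (inr j) then F i else 0)) /=.
  apply: eq_bigr => i _; rewrite sumr_const card_ord -mulr_natr -mulrA divfK//.
  rewrite (degree_inl _ _ _ he) natr_sum mulr_sumr; apply: eq_bigr => j _.
  by case: (e _ _); rewrite (mulr1, mulr0).
have hy (F : 'I_n.+1 -> R) : \sum_(u : 'I_n.+1 * 'I_n.+1) F u.2 * vy u.2 = \sum_(u | A u) F u.2.
  rewrite [RHS]big_mkcond -(pair_bigA _ (fun i j => F j * vy j)).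
  rewrite -(pair_bigA _ (fun i j => if e (inl i) (inr j) then F j else 0)) /=.
  rewrite exchange_big [RHS]exchange_big /=.
  apply: eq_bigr => j _; rewrite sumr_const card_ord -mulr_natr -mulrA divfK//.
  rewrite (degree_inr _ _ _ he) natr_sum mulr_sumr; apply: eq_bigr => i _.
  by case: (e _ _); rewrite (mulr1, mulr0).
pose p1 : 'I_n.+1 * 'I_n.+1 -> 'I_n.+1 := fst.
pose p2 : 'I_n.+1 * 'I_n.+1 -> 'I_n.+1 := snd.
pose X0 := coded_fun R _ _ p1 vx.
pose Y0 := coded_fun R _ _ p2 vy.
have mX : measurable_fun setT X0 by [].
have mY : measurable_fun setT Y0 by [].
pose X : {RV P >-> R} := HB.pack X0 (isMeasurableFun.Build _ _ _ _ X0 mX).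
pose Y : {RV P >-> R} := HB.pack Y0 (isMeasurableFun.Build _ _ _ _ Y0 mY).
have XE (u : 'I_n.+1 * 'I_n.+1) : X0 (pickle u) = vx u.1.
  by rewrite /X0 /coded_fun /coded pickleK.
have YE (u : 'I_n.+1 * 'I_n.+1) : Y0 (pickle u) = vy u.2.
  by rewrite /Y0 /coded_fun /coded pickleK.
exists _, _, P, X, Y; split.
- exists (coded_event _ A), (coded_field _ _ p1), (coded_field _ _ p2); split.
  + by [].
  + exact: coded_sub_sigma_field.
  + exact: coded_sub_sigma_field.
  + exact: (coded_is_cond_prob _ _ _ PE intPE _ _ _ _ vx0 hx).
  + exact: (coded_is_cond_prob _ _ _ PE intPE _ _ _ _ vy0 hy).
- move=> B C _ _; rewrite !PE -EFinM; congr _%:E.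
  pose a i : R := \1_B (vx i); pose b j : R := \1_C (vy j).
  rewrite card_prod card_ord natrM.
  rewrite (eq_bigr (fun u => a u.1 * b u.2)); last first.
    move=> u _; rewrite indicI /=; congr (_ * _).
      by rewrite /a -XE !indicE.
    by rewrite /b -YE !indicE.
  rewrite [X in _ = _ * X * _](eq_bigr (fun u => a u.1)); last first.
    by move=> u _; rewrite /a -XE !indicE.
  rewrite [X in _ = _ * (_ * X)](eq_bigr (fun u => b u.2)); last first.
    by move=> u _; rewrite /b -YE !indicE.
  (* The joint sum over the square factors, and each marginal sum gains a factor [n.+1] from its
     free coordinate. *)
  rewrite -(pair_bigA _ (fun i j => a i * b j)) /=.
  rewrite -(pair_bigA _ (fun i j => a i)) -(pair_bigA _ (fun i j => b j)) /=.
  under [X in _ = _ * X * _]eq_bigr do rewrite sumr_const card_ord.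
  rewrite sumr_const card_ord sumrMnl -big_distrlr /=.
  rewrite -[X in _ = _ * X * _]mulr_natr -[X in _ = _ * (_ * X)]mulr_natr.
  set w := n.+1%:R; set u := \sum_i a i; set v := \sum_j b j.
  rewrite [RHS](_ : _ = (w^-1 * w) * (w^-1 * w) * ((w * w)^-1 * (u * v))).
    by rewrite mulVf// !mul1r.
  by rewrite !invfM !mulrA [LHS](ACl (1*4*5*8*2*6*3*7)).
rewrite unlock intPE; last by move=> w; rewrite exprn_ge0.
congr _%:E; rewrite /degree_moment card_prod card_ord natrM.
rewrite (eq_bigr (fun u => `|vx u.1 - vy u.2| ^+ k)); last first.
  by move=> u _; rewrite indicT mulr1 -XE -YE.
rewrite -(pair_bigA _ (fun i j => `|vx i - vy j| ^+ k)) /=.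
rewrite exprD expr2 invfM -mulrA; congr (_ * _).
rewrite mulr_sumr; apply: eq_bigr => i _; rewrite mulr_sumr; apply: eq_bigr => j _.
by rewrite /vx /vy -mulrBl normrM normfV (ger0_norm (ler0n R n.+1)) exprMn exprVn mulrC.
Qed.

Theorem theorem4p1 (R : realType) (k : nat) (hk : (3 <= k)%N) :
  ereal_sup (coherent_indep_moments R k) =
  ereal_sup [set ereal_sup [set (degree_moment R k e)%:E
                           | e in bipartite_graphs n]
            | n in [set n : nat | (0 < n)%N]].
Proof.
apply/eqP; rewrite eq_le; apply/andP; split.
  apply: ge_ereal_sup => _ [d [T [P [X [Y [cXY iXY ->]]]]]].
  exact: coherent_moment_le_sup.
apply: ge_ereal_sup => _ [n n0 <-]; apply: ge_ereal_sup => _ [e he <-].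
by apply: ereal_sup_ubound; exact: degree_moment_coherent.
Qed.
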